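(* Let $F$ be a field and let $A=F\langle x_1,\dots,x_m\rangle/I$ and $B=F\langle x_1,\dots,x_{m'}\rangle/J$ be monomial algebras, presented with no redundant generators, i.e. $x_1,\dots,x_m\notin I$ and $x_1,\dots,x_{m'}\notin J$. (i) If $A\cong B$ as $F$-algebras, then there is an isomorphism between them given by a permutation on the generators, i.e. $m=m'$ and there is $\sigma\in S_m$ such that $x_i\mapsto x_{\sigma(i)}$ induces an isomorphism $A\to B$. (ii) If moreover $A,B$ are projectively simple, then every graded isomorphism between them is given by a permutation and scaling of the generators, i.e. is of the form $x_i\mapsto\lambda_ix_{\sigma(i)}$ with $\sigma\in S_m$ and $\lambda_1,\dots,\lambda_m\in F^\times$. In particular, for a projectively simple monomial algebra $A$ with $n$ generators, $\mathrm{Aut}_{\mathrm{gr}}(A)\le\mathbb G_m\wr S_n=\mathbb G_m^{\times n}\rtimes S_n$.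
   Context: A monomial algebra is a quotient of a finitely generated free associative algebra $F\langle x_1,\dots,x_m\rangle$ by a proper ideal generated by monomials, graded by $\deg x_i=1$. A graded algebra is projectively simple if it is infinite-dimensional but all of its proper graded homomorphic images are finite-dimensional. $\mathrm{Aut}_{\mathrm{gr}}(A)$ is the group of graded (degree-preserving) $F$-algebra automorphisms; $\mathbb G_m=F^\times$, and $\mathbb G_m\wr S_n$ acts on $A_1=Fx_1+\cdots+Fx_n$ by permuting and scaling the generators. *)

(* Defs.v *)
From HB Require Import structures.
From mathcomp Require Import all_boot all_order all_fingroup all_algebra.
From mathcomp Require Import generic_quotient ring_quotient finmap boolp monalg.

Set Implicit Arguments.
Unset Strict Implicit.
Unset Printing Implicit Defensive.

Import GRing.Theory.
Local Open Scope ring_scope.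
Local Open Scope quotient_scope.

(* {fmonom 'I_m} is the free monoid on 'I_m, so that {malg F[{fmonom 'I_m}]}
   is F<x_1, ..., x_m>; monalg equips it with an algType structure only when
   the monoid is commutative. *)
Definition free_alg (F : fieldType) (m : nat) : Type := {malg F[{fmonom 'I_m}]}.

Section FreeAlg.
Variables (F : fieldType) (m : nat).
HB.instance Definition _ := GRing.Lalgebra.on (free_alg F m).

Lemma free_alg_scalerAr (k : F) (x y : free_alg F m) :
  k *: (x * y) = x * (k *: y).
Proof.
apply/malgP => w; rewrite mcoeffZ.
rewrite (mcoeffMlw w (fsubset_refl _) (fsubset_refl _)).
rewrite (mcoeffMlw w (fsubset_refl _) (msuppZ_le k y)).
rewrite mulr_sumr; apply: eq_bigr => u _; rewrite mulr_sumr.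
apply: eq_bigr => v _; rewrite mcoeffZ -mulrnAr.
by rewrite mulrnAr mulrnAr mulrCA.
Qed.

HB.instance Definition _ :=
  GRing.Lalgebra_isAlgebra.Build F (free_alg F m) free_alg_scalerAr.

Definition word (w : {fmonom 'I_m}) : free_alg F m := mkmalgU w 1.
Definition free_gen (i : 'I_m) : free_alg F m := word (fmu i).
End FreeAlg.

(* As in the library, an [idealr] is a proper ideal, stable by
   multiplication on the left. *)
HB.mixin Record isMulrStable (R : nzRingType) (S : R -> bool) := {
  idealMl : forall a, {in S, forall u, u * a \in S}
}.

#[short(type="two_sided_ideal")]
HB.structure Definition TwoSidedIdeal (R : nzRingType) :=
  {S of Idealr R S & isMulrStable R S}.

Definition ideal_generated (R : nzRingType) (X : R -> Prop) (r : R) : Prop :=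
  exists (n : nat) (a x b : 'I_n -> R),
    (forall i, X (x i)) /\ r = \sum_(i < n) a i * x i * b i.

HB.mixin Record isMonomialIdeal (F : fieldType) (m : nat)
    (S : free_alg F m -> bool) := {
  monomial_idealP : exists W : {fmonom 'I_m} -> Prop, forall p,
    p \in S <-> ideal_generated (fun q => exists2 w, W w & q = word F w) p
}.

#[short(type="monomial_ideal")]
HB.structure Definition MonomialIdeal (F : fieldType) (m : nat) :=
  {S of TwoSidedIdeal (free_alg F m) S & isMonomialIdeal F m S}.

(* The library makes {ideal_quot I} a ring only over a commutative ring. *)
Definition quot_alg (F : fieldType) (A : algType F) (I : two_sided_ideal A) :
  Type := Quotient.quot I.

Section QuotAlg.
Variables (F : fieldType) (A : algType F) (I : two_sided_ideal A).
Local Notation Q := (quot_alg I).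

HB.instance Definition _ := GRing.Zmodule.on Q.
HB.instance Definition _ := EqQuotient.on Q.

Definition qpi (x : A) : Q := \pi_(Quotient.quot I) x.

Lemma qpiP x y : reflect (qpi x = qpi y) (x - y \in (I : {pred A})).
Proof. by rewrite Quotient.idealrBE; apply: eqP. Qed.

Lemma qpi_surj q : exists x, qpi x = q.
Proof. by exists (repr q); apply: reprK. Qed.

Lemma qpiD x y : qpi (x + y) = qpi x + qpi y.
Proof. exact: Quotient.pi_add. Qed.
Lemma qpiN x : qpi (- x) = - qpi x.
Proof. exact: Quotient.pi_opp. Qed.

Definition qone : Q := qpi 1.
Definition qmul (x y : Q) : Q := qpi (repr x * repr y).
Definition qscale (k : F) (x : Q) : Q := qpi (k *: repr x).

Lemma repr_qpi x : repr (qpi x) - x \in (I : {pred A}).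
Proof. by apply/qpiP; apply: reprK. Qed.

Lemma qpiM x y : qpi (x * y) = qmul (qpi x) (qpi y).
Proof.
apply/esym/qpiP; set x' := repr _; set y' := repr _.
have -> : x' * y' - x * y = x' * (y' - y) + (x' - x) * y.
  by rewrite mulrBr mulrBl addrA subrK.
apply: rpredD; first by apply/idealMr/repr_qpi.
exact/idealMl/repr_qpi.
Qed.

Lemma qpiZ k x : qpi (k *: x) = qscale k (qpi x).
Proof.
apply/esym/qpiP; rewrite -scalerBr -[_ - x]mul1r scalerAl.
by rewrite idealMr ?repr_qpi.
Qed.

Lemma qmulA : associative qmul.
Proof.
move=> x y z; case: (qpi_surj x) (qpi_surj y) (qpi_surj z).
by move=> a <- [b <-] [c <-]; rewrite -!qpiM mulrA.
Qed.
Lemma qmul1 : left_id qone qmul.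
Proof. by move=> x; case: (qpi_surj x) => a <-; rewrite -qpiM mul1r. Qed.
Lemma q1mul : right_id qone qmul.
Proof. by move=> x; case: (qpi_surj x) => a <-; rewrite -qpiM mulr1. Qed.
Lemma qmulDl : left_distributive qmul +%R.
Proof.
move=> x y z; case: (qpi_surj x) (qpi_surj y) (qpi_surj z).
by move=> a <- [b <-] [c <-]; rewrite -!(qpiM, qpiD) mulrDl.
Qed.
Lemma qmulDr : right_distributive qmul +%R.
Proof.
move=> x y z; case: (qpi_surj x) (qpi_surj y) (qpi_surj z).
by move=> a <- [b <-] [c <-]; rewrite -!(qpiM, qpiD) mulrDr.
Qed.
Lemma qone_neq0 : qone != 0.
Proof.
apply/eqP; have -> : 0 = qpi 0 by rewrite -[in RHS](subrr 0) qpiD qpiN subrr.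
by move/qpiP; rewrite subr0 idealr1.
Qed.

HB.instance Definition _ := GRing.Zmodule_isNzRing.Build Q
  qmulA qmul1 q1mul qmulDl qmulDr qone_neq0.

Lemma qscaleA a b v : qscale a (qscale b v) = qscale (a * b) v.
Proof. by case: (qpi_surj v) => x <-; rewrite -!qpiZ scalerA. Qed.
Lemma qscale1 : left_id 1 qscale.
Proof. by move=> v; case: (qpi_surj v) => x <-; rewrite -!qpiZ scale1r. Qed.
Lemma qscaleDr : right_distributive qscale +%R.
Proof.
move=> k u v; case: (qpi_surj u) (qpi_surj v) => x <- [y <-].
by rewrite -!(qpiD, qpiZ) scalerDr.
Qed.
Lemma qscaleDl v : {morph qscale^~ v : a b / a + b}.
Proof.
by move=> a b; case: (qpi_surj v) => x <-; rewrite -!(qpiD, qpiZ) scalerDl.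
Qed.

HB.instance Definition _ := GRing.Zmodule_isLmodule.Build F Q
  qscaleA qscale1 qscaleDr qscaleDl.

Lemma qscalerAl k (u v : Q) : k *: (u * v) = (k *: u) * v.
Proof.
case: (qpi_surj u) (qpi_surj v) => x <- [y <-].
by rewrite -[LHS]/(qscale k (qmul _ _)) -[RHS]/(qmul (qscale k _) _)
  -!(qpiM, qpiZ) scalerAl.
Qed.
HB.instance Definition _ := GRing.Lmodule_isLalgebra.Build F Q qscalerAl.

Lemma qscalerAr k (u v : Q) : k *: (u * v) = u * (k *: v).
Proof.
case: (qpi_surj u) (qpi_surj v) => x <- [y <-].
by rewrite -[LHS]/(qscale k (qmul _ _)) -[RHS]/(qmul _ (qscale k _))
  -!(qpiM, qpiZ) scalerAr.
Qed.
HB.instance Definition _ := GRing.Lalgebra_isAlgebra.Build F Q qscalerAr.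

Lemma qpi_is_zmod_morphism : zmod_morphism qpi.
Proof. by move=> x y; rewrite qpiD qpiN. Qed.
HB.instance Definition _ :=
  GRing.isZmodMorphism.Build A Q qpi qpi_is_zmod_morphism.
Lemma qpi_is_monoid_morphism : monoid_morphism qpi.
Proof. by split=> // x y; rewrite qpiM. Qed.
HB.instance Definition _ :=
  GRing.isMonoidMorphism.Build A Q qpi qpi_is_monoid_morphism.
Lemma qpi_is_scalable : scalable qpi.
Proof. by move=> k x; rewrite qpiZ. Qed.
HB.instance Definition _ :=
  GRing.isScalable.Build F A Q *:%R qpi qpi_is_scalable.
End QuotAlg.


HB.mixin Record isGradedAlgebra (F : fieldType) A of GRing.Algebra F A := {
  homog : nat -> A -> Prop;
  homog0 : forall d, homog d 0;
  homogP : forall d k a b, homog d a -> homog d b -> homog d (k *: a + b);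
  homog1 : homog 0%N 1;
  homogM : forall d e a b, homog d a -> homog e b -> homog (d + e)%N (a * b);
  homog_dec : forall a, exists (n : nat) (c : nat -> A),
    (forall d, homog d (c d)) /\ a = \sum_(d < n) c d;
  homog_indep : forall (n : nat) (c : nat -> A),
    (forall d, homog d (c d)) -> \sum_(d < n) c d = 0 ->
    forall d, (d < n)%N -> c d = 0
}.

#[short(type="gradedAlgType")]
HB.structure Definition GradedAlgebra (F : fieldType) :=
  {A of GRing.Algebra F A & isGradedAlgebra F A}.

Arguments homog {F A} : rename.

Definition graded_map (F : fieldType) (A B : gradedAlgType F) (f : A -> B) :=
  forall d a, homog d a -> homog d (f a).

Definition finite_dimensional (F : fieldType) (V : lmodType F) : Prop :=
  exists (n : nat) (e : 'I_n -> V),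
    forall v, exists c : 'I_n -> F, v = \sum_(i < n) c i *: e i.

(* An algType is nonzero, so the zero image, which is finite-dimensional, does
   not occur among the C. *)
Definition projectively_simple (F : fieldType) (A : gradedAlgType F) : Prop :=
  ~ finite_dimensional A /\
  forall (C : gradedAlgType F) (f : {lrmorphism A -> C}),
    graded_map f -> (forall c, exists a, f a = c) -> ~ injective f ->
    finite_dimensional C.

Section WordGrading.
Variables (F : fieldType) (m : nat).
Local Notation R := (free_alg F m).

Definition word_homog (d : nat) (p : R) : Prop :=
  forall w : {fmonom 'I_m}, p@_w != 0 -> fdeg w = d.

Definition hpart (d : nat) (p : R) : R :=
  [malg w in msupp p => if fdeg w == d then p@_w else 0].

Lemma hpartE d p w : (hpart d p)@_w = if fdeg w == d then p@_w else 0.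
Proof.
rewrite mcoeffE; case: ifPn => // wp.
by rewrite (mcoeff_outdom wp) if_same.
Qed.

Lemma hpartP d p : word_homog d (hpart d p).
Proof. by move=> w; rewrite hpartE; case: (fdeg w =P d) => // _; rewrite eqxx. Qed.

Lemma hpartD d : {morph hpart d : p q / p + q}.
Proof.
move=> p q; apply/malgP => w; rewrite mcoeffD !hpartE mcoeffD.
by case: ifP; rewrite ?addr0.
Qed.

Lemma hpart0 d : hpart d 0 = 0.
Proof. by apply/malgP => w; rewrite hpartE mcoeff0 if_same. Qed.

Lemma hpart_homog d e p :
  word_homog e p -> hpart d p = if e == d then p else 0.
Proof.
move=> hp; apply/malgP => w; rewrite hpartE.
have [/eqP pw0|/hp ->] := boolP (p@_w == 0); last by case: ifP => //; rewrite mcoeff0.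
by rewrite pw0 if_same; case: ifP; rewrite ?pw0 ?mcoeff0.
Qed.

Lemma hpart_sum p :
  exists n, p = \sum_(d < n) hpart d p.
Proof.
exists (\max_(w <- msupp p) fdeg w).+1; apply/malgP => w.
rewrite raddf_sum /=; under eq_bigr do rewrite hpartE.
case: (msuppP p w) => [wp|_]; last by rewrite big1 // => d _; rewrite if_same.
have dw : (fdeg w < (\max_(w <- msupp p) fdeg w).+1)%N.
  by rewrite ltnS; apply: leq_bigmax_seq.
rewrite (bigD1 (Ordinal dw)) //= eqxx big1 ?addr0 // => d.
by rewrite -val_eqE /= eq_sym => /negPf ->.
Qed.

Lemma free_algE (p : R) : p = \sum_(w <- msupp p) (mkmalgU w p@_w : R).
Proof. exact: monalgE. Qed.

Lemma word_homogU c w : word_homog (fdeg w) (mkmalgU w c : R).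
Proof.
by move=> v; rewrite mcoeffU; case: (w =P v) => [-> //|_]; rewrite mulr0n eqxx.
Qed.

Lemma word_homogM d e p q :
  word_homog d p -> word_homog e q -> word_homog (d + e)%N (p * q).
Proof.
move=> hp hq w; rewrite mcoeff_neq0 => /msuppM_le[u [v [up vq ->]]].
by rewrite fdegM (hp u) ?(hq v) // mcoeff_neq0.
Qed.
End WordGrading.

Definition monomial_alg (F : fieldType) (m : nat) (I : monomial_ideal F m) :
  Type := quot_alg I.

Section MonomialAlg.
Variables (F : fieldType) (m : nat) (I : monomial_ideal F m).
Local Notation R := (free_alg F m).
Local Notation A := (monomial_alg I).

HB.instance Definition _ := GRing.Algebra.on A.

Definition mono_homog (d : nat) (a : A) : Prop :=
  exists2 p : R, word_homog d p & a = qpi I p.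

Lemma hpart_ideal d (p : R) :
  p \in (I : {pred R}) -> hpart d p \in (I : {pred R}).
Proof.
have [W IW] := @monomial_idealP _ _ I.
move=> /IW[n [a [x [b [Wx ->]]]]].
rewrite (big_morph _ (@hpartD F m d) (hpart0 F m d)); apply: rpred_sum => i _.
have xI : x i \in (I : {pred R}).
  apply/IW; exists 1, (fun=> 1), (fun=> x i), (fun=> 1); split=> //.
  by rewrite big_ord1 mul1r mulr1.
have [w _ xw] := Wx i.
rewrite [a i]free_algE -mulrA mulr_suml.
rewrite (big_morph _ (@hpartD F m d) (hpart0 F m d)); apply: rpred_sum => u _.
rewrite [b i]free_algE mulrA mulr_sumr.
rewrite (big_morph _ (@hpartD F m d) (hpart0 F m d)); apply: rpred_sum => v _.
have hh : word_homog (fdeg u + fdeg w + fdeg v)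
    (mkmalgU u (a i)@_u * x i * mkmalgU v (b i)@_v : R).
  by rewrite xw; do 2?apply: word_homogM; apply: word_homogU.
rewrite (hpart_homog _ hh); case: ifP => _; last exact: rpred0.
exact/idealMl/idealMr.
Qed.

Lemma mono_homog0 d : mono_homog d 0.
Proof. by exists 0; [move=> w; rewrite mcoeff0 eqxx | rewrite raddf0]. Qed.

Lemma mono_homogP d k (a b : A) :
  mono_homog d a -> mono_homog d b -> mono_homog d (k *: a + b).
Proof.
move=> [p hp ->] [q hq ->]; exists (k *: p + q); last by rewrite linearP.
move=> w; have [/eqP pw|/hp //] := boolP (p@_w == 0).
by rewrite mcoeffD mcoeffZ pw mulr0 add0r => /hq.
Qed.

Lemma mono_homog1 : mono_homog 0 1.
Proof. by exists 1 => // w; rewrite mcoeff1; case: (w =P mone) => [->|_]; rewrite ?fdeg1 ?eqxx. Qed.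

Lemma mono_homogM d e (a b : A) :
  mono_homog d a -> mono_homog e b -> mono_homog (d + e)%N (a * b).
Proof.
move=> [p hp ->] [q hq ->]; exists (p * q); last by rewrite rmorphM.
exact: word_homogM.
Qed.

Lemma mono_homog_dec (a : A) : exists (n : nat) (c : nat -> A),
  (forall d, mono_homog d (c d)) /\ a = \sum_(d < n) c d.
Proof.
have [p <-] := qpi_surj a; have [n {1}->] := hpart_sum p.
exists n, (fun d => qpi I (hpart d p)); split; last by rewrite raddf_sum.
by move=> d; exists (hpart d p) => //; apply: hpartP.
Qed.

Lemma mono_homog_indep (n : nat) (c : nat -> A) :
  (forall d, mono_homog d (c d)) -> \sum_(d < n) c d = 0 ->
  forall d, (d < n)%N -> c d = 0.
Proof.
move=> hc; pose p d := projT1 (cid2 (hc d)).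
have hp d : word_homog d (p d) /\ c d = qpi I (p d).
  by rewrite /p; case: (cid2 _).
rewrite (eq_bigr (fun d : 'I_n => qpi I (p d))); last by move=> d _; case: (hp d).
have q0 : 0 = qpi I 0 :> A by rewrite raddf0.
rewrite -raddf_sum q0 => /(introT (qpiP _ _ _)).
rewrite subr0 => sI d dn; rewrite (hp d).2.
apply/qpiP; rewrite subr0.
have := hpart_ideal d sI; rewrite (big_morph _ (@hpartD F m d) (hpart0 F m d)).
rewrite (bigD1 (Ordinal dn)) //= (hpart_homog _ (hp d).1) eqxx big1 ?addr0 //.
by move=> e; rewrite -val_eqE /= (hpart_homog _ (hp e).1) => /negPf ->.
Qed.

HB.instance Definition _ := isGradedAlgebra.Build F A
  mono_homog0 mono_homogP mono_homog1 mono_homogM mono_homog_dec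
  mono_homog_indep.

Definition gen (i : 'I_m) : A := qpi I (free_gen F i).
End MonomialAlg.

Section GradedAut.
Variables (F : fieldType) (A : gradedAlgType F).

Record graded_aut := GradedAut {
  aut_hom :> {lrmorphism A -> A};
  aut_bij : bijective aut_hom;
  aut_graded : graded_map aut_hom
}.

Lemma graded_autP (f g : graded_aut) : f =1 g -> f = g.
Proof.
case: f g => [f fb fg] [g gb gg] /= /funext fgE.
have {}fgE : f = g.
  case: f g fgE {fb fg gb gg} => [f cf] [g cg] /= fE.
  case: _ / fE in cg *; congr GRing.LRMorphism.Pack.
  by case: cf cg => [[?] [?] [?]] [[?] [?] [?]]; congr GRing.LRMorphism.Class;
    congr (_ _); apply: Prop_irrelevance.
by subst g; congr GradedAut; apply: Prop_irrelevance.
Qed.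

(* As for {perm T}, a product of automorphisms applies its left factor first. *)
Definition aut_mul (f g : graded_aut) : graded_aut :=
  @GradedAut (g \o f : A -> A) (bij_comp (aut_bij g) (aut_bij f))
    (fun d a ha => aut_graded g (aut_graded f ha)).

Definition aut_one : graded_aut :=
  @GradedAut (idfun : A -> A) (Bijective (fun=> erefl) (fun=> erefl))
    (fun d a ha => ha).

Section Inverse.
Variable f : graded_aut.

Lemma aut_inv_exists : exists g : A -> A, cancel f g /\ cancel g f.
Proof. by case: (aut_bij f) => g fK gK; exists g. Qed.

Definition aut_inv_fun : A -> A := projT1 (cid aut_inv_exists).
Lemma aut_funK : cancel f aut_inv_fun.
Proof. exact: (projT2 (cid aut_inv_exists)).1. Qed.
Lemma aut_inv_funK : cancel aut_inv_fun f.
Proof. exact: (projT2 (cid aut_inv_exists)).2. Qed.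

HB.instance Definition _ := GRing.isZmodMorphism.Build A A aut_inv_fun
  (can2_zmod_morphism aut_funK aut_inv_funK).
HB.instance Definition _ := GRing.isMonoidMorphism.Build A A aut_inv_fun
  (can2_monoid_morphism aut_funK aut_inv_funK).
HB.instance Definition _ := GRing.isScalable.Build F A A *:%R aut_inv_fun
  (can2_scalable aut_funK aut_inv_funK).

Lemma aut_inv_graded : graded_map aut_inv_fun.
Proof.
move=> d a ha; have [n [c [hc ga]]] := homog_dec (aut_inv_fun a).
have fa : a = \sum_(e < n) f (c e) by rewrite -[LHS]aut_inv_funK ga raddf_sum.
pose c1 e := if (e < n)%N then c e else 0.
have hc1 e : homog e (c1 e) by rewrite /c1; case: ifP => _ //; apply: homog0.
have c1E e : f (c1 e) = if (e < n)%N then f (c e) else 0.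
  by rewrite /c1; case: ifP => //; rewrite raddf0.
pose c2 e := f (c1 e) - (if e == d then a else 0).
have hc2 e : homog e (c2 e).
  rewrite /c2 addrC -scaleN1r; apply: homogP; last exact/(aut_graded f).
  by case: eqP => [->|_] //; apply: homog0.
have s0 : \sum_(e < maxn n d.+1) c2 e = 0.
  rewrite sumrB [X in _ - X](bigD1 (Ordinal (leq_maxr n d.+1))) //= eqxx.
  rewrite [X in a + X]big1; last by move=> e; rewrite -val_eqE /= => /negPf ->.
  rewrite addr0 [X in X - _](_ : _ = a) ?subrr // [RHS]fa.
  rewrite (big_ord_widen _ (fun e => f (c e)) (leq_maxl n d.+1)).
  by rewrite [RHS]big_mkcond /=; apply: eq_bigr => e _; rewrite c1E.
have /eqP := homog_indep _ _ hc2 s0 d (leq_maxr n d.+1).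
rewrite /c2 eqxx subr_eq0 => /eqP <-.
by rewrite aut_funK.
Qed.

Definition aut_inv : graded_aut :=
  @GradedAut aut_inv_fun (Bijective aut_inv_funK aut_funK) aut_inv_graded.
End Inverse.

HB.instance Definition _ := gen_eqMixin graded_aut.
HB.instance Definition _ := gen_choiceMixin graded_aut.

Lemma aut_mulA : associative aut_mul.
Proof. by move=> f g h; apply: graded_autP. Qed.
Lemma aut_mul1 : left_id aut_one aut_mul.
Proof. by move=> f; apply: graded_autP. Qed.
Lemma aut_1mul : right_id aut_one aut_mul.
Proof. by move=> f; apply: graded_autP. Qed.
Lemma aut_mulV : left_inverse aut_one aut_inv aut_mul.
Proof. by move=> f; apply: graded_autP => a /=; rewrite aut_inv_funK. Qed.
Lemma aut_Vmul : right_inverse aut_one aut_inv aut_mul.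
Proof. by move=> f; apply: graded_autP => a /=; rewrite aut_funK. Qed.

HB.instance Definition _ := isGroup.Build graded_aut
  aut_mulA aut_mul1 aut_1mul aut_mulV aut_Vmul.
End GradedAut.

Section MultiplicativeGroup.
Variable F : fieldType.

Record Gm : Type := MkGm { Gm_val :> F; Gm_neq0 : Gm_val != 0 }.

HB.instance Definition _ := [isSub for Gm_val].
HB.instance Definition _ := [Choice of Gm by <:].

Definition Gm_one : Gm := MkGm (oner_neq0 F).
Definition Gm_mul (a b : Gm) : Gm := MkGm (mulf_neq0 (Gm_neq0 a) (Gm_neq0 b)).
Definition Gm_inv (a : Gm) : Gm := MkGm (invr_neq0 (Gm_neq0 a)).

Lemma Gm_mulA : associative Gm_mul.
Proof. by move=> a b c; apply: val_inj; rewrite /= mulrA. Qed.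
Lemma Gm_mul1 : left_id Gm_one Gm_mul.
Proof. by move=> a; apply: val_inj; rewrite /= mul1r. Qed.
Lemma Gm_1mul : right_id Gm_one Gm_mul.
Proof. by move=> a; apply: val_inj; rewrite /= mulr1. Qed.
Lemma Gm_mulV : left_inverse Gm_one Gm_inv Gm_mul.
Proof. by move=> a; apply: val_inj; rewrite /= mulVf ?Gm_neq0. Qed.
Lemma Gm_Vmul : right_inverse Gm_one Gm_inv Gm_mul.
Proof. by move=> a; apply: val_inj; rewrite /= mulfV ?Gm_neq0. Qed.

HB.instance Definition _ := isGroup.Build Gm
  Gm_mulA Gm_mul1 Gm_1mul Gm_mulV Gm_Vmul.
End MultiplicativeGroup.

(* The semidirect product G^n ><| 'S_n, where s acts on G^n by
   b |-> (i |-> b (s i)). With products in 'S_n applying their left factor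
   first, this is a left action, and (a, s) |-> (x_i |-> a_i x_(s i)) is
   compatible with products. *)
Record wreath (G : groupType) (n : nat) : Type :=
  Wreath { wr_scale : {ffun 'I_n -> G}; wr_perm : 'S_n }.

Section Wreath.
Local Open Scope group_scope.
Variables (G : groupType) (n : nat).
Local Notation W := (wreath G n).

HB.instance Definition _ := gen_eqMixin W.
HB.instance Definition _ := gen_choiceMixin W.

Definition wreath_one : W := Wreath [ffun=> 1] 1.
Definition wreath_mul (u v : W) : W :=
  Wreath [ffun i => wr_scale u i * wr_scale v (wr_perm u i)]
    (wr_perm u * wr_perm v).
Definition wreath_inv (u : W) : W :=
  Wreath [ffun i => (wr_scale u ((wr_perm u)^-1 i))^-1] (wr_perm u)^-1.

Lemma wreath_mulA : associative wreath_mul.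
Proof.
move=> u v w; congr Wreath; last exact: mulgA.
by apply/ffunP => i; rewrite !ffunE /= permM mulgA.
Qed.
Lemma wreath_mul1 : left_id wreath_one wreath_mul.
Proof.
case=> a s; congr Wreath; last exact: mul1g.
by apply/ffunP => i; rewrite !ffunE /= perm1 mul1g.
Qed.
Lemma wreath_1mul : right_id wreath_one wreath_mul.
Proof.
case=> a s; congr Wreath; last exact: mulg1.
by apply/ffunP => i; rewrite !ffunE /= mulg1.
Qed.
Lemma wreath_mulV : left_inverse wreath_one wreath_inv wreath_mul.
Proof.
case=> a s; congr Wreath; last exact: mulVg.
by apply/ffunP => i; rewrite !ffunE /= mulVg.
Qed.
Lemma wreath_Vmul : right_inverse wreath_one wreath_inv wreath_mul.
Proof.
case=> a s; congr Wreath; last exact: mulgV.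
by apply/ffunP => i; rewrite !ffunE /= permK mulgV.
Qed.

HB.instance Definition _ := isGroup.Build W
  wreath_mulA wreath_mul1 wreath_1mul wreath_mulV wreath_Vmul.
End Wreath.

(* Main.v *)
(** Let f : A -> B be an isomorphism, c_i the constant term of f(x_i), and
    y_i = x_i - c_i. A word in the y's differs from the same word in the x's by
    terms of smaller degree, so the words of length at most k in the x's and
    those in the y's have the same span V_k in A. As f(y_i) has no constant
    term, V_k maps onto B / B_{>k}; by symmetry the two spaces have the same
    dimension, so no nonzero element of V_k is sent to B_{>k}. If a word w of
    length k + 1 vanishes in A, the corresponding word in the y's lies in V_k
    and its image in B_{>k}, so it vanishes as well; the lowest-degree part of
    its image is the product along w of the linear parts of the f(x_i), which
    is therefore 0.

    In other words, let a be the (invertible) Jacobian of f. If v is a nonzero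
    word of B and w a word with all a_{w_p v_p} nonzero, then w is nonzero in A.
    Choose a permutation s with all a_{i s(i)} nonzero: relettering by s^-1
    sends nonzero words of B to nonzero words of A. The inverse of f gives a
    permutation in the other direction, and permutations have finite order, so
    this correspondence is a bijection between nonzero words. *)

From HB Require Import structures.
Require Import Defs.
From mathcomp Require Import all_boot all_order all_fingroup all_algebra.
From mathcomp Require Import finmap boolp monalg.

Set Implicit Arguments.
Unset Strict Implicit.
Unset Printing Implicit Defensive.

Import GRing.Theory.
Local Open Scope ring_scope.

(** * Monomial bases *)

(* A spanning set of monomials whose nonzero members are linearly independent:
   all that the argument uses of a monomial presentation. The coefficient
   function coef s is 0 by convention when the monomial of s vanishes. *)
Record monomial_basis (F : fieldType) (m : nat) (A : algType F) :=
  MonomialBasis {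
  vanish : pred (seq 'I_m);
  mon : seq 'I_m -> A;
  coef : seq 'I_m -> A -> F;
  coef_is_linear : forall s, linear_for *%R (coef s);
  coef_inj : forall a, (forall s, coef s a = 0) -> a = 0;
  coef_vanish : forall s a, vanish s -> coef s a = 0;
  coef_mon : forall s t, coef s (mon t) = (~~ vanish s && (t == s))%:R;
  mon_nil : mon [::] = 1;
  mon_cat : forall s t, mon (s ++ t) = mon s * mon t;
  vanish_nil : vanish [::] = false;
  mon_span : forall a, exists (r : seq (seq 'I_m)) (c : seq 'I_m -> F),
    a = \sum_(s <- r) c s *: mon s
}.

HB.instance Definition _ (F : fieldType) (m : nat) (A : algType F)
    (X : monomial_basis m A) s :=
  GRing.isLinear.Build F A F *%R (coef X s) (coef_is_linear X s).

Section MonomialBasis.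
Variables (F : fieldType) (m : nat) (A : algType F) (X : monomial_basis m A).
Implicit Types (s t : seq 'I_m) (a b : A).
Local Notation vanish := (vanish X).
Local Notation mon := (mon X).
Local Notation coef := (coef X).

Definition letter i : A := mon [:: i].

Lemma coef_ext a b : (forall s, ~~ vanish s -> coef s a = coef s b) -> a = b.
Proof.
move=> E; apply/eqP; rewrite -subr_eq0; apply/eqP.
apply: (@coef_inj _ _ _ X) => s.
rewrite raddfB /=; have [v|/E ->] := boolP (vanish s); last exact: subrr.
by rewrite !coef_vanish ?subrr.
Qed.

Lemma mon_vanish s : vanish s -> mon s = 0.
Proof.
move=> vs; apply: coef_ext => t nt; rewrite raddf0 coef_mon.
by case: eqP nt => [<-|_ _]; rewrite ?vs ?andbF.
Qed.

Lemma vanish_cat s t : vanish s || vanish t -> vanish (s ++ t).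
Proof.
move=> v; have: mon (s ++ t) = 0.
  by rewrite mon_cat; case/orP: v => /mon_vanish ->; rewrite ?mul0r ?mulr0.
move/(congr1 (coef (s ++ t))); rewrite raddf0 coef_mon eqxx andbT.
by case: (vanish _) => // /eqP; rewrite oner_eq0.
Qed.

Lemma mon_prod s : mon s = \prod_(i <- s) letter i.
Proof.
elim: s => [|i s IHs]; first by rewrite big_nil mon_nil.
by rewrite big_cons -IHs -mon_cat.
Qed.

Lemma mon_ind (P : A -> Prop) :
  P 0 -> (forall k a b, P a -> P b -> P (k *: a + b)) ->
  (forall s, P (mon s)) -> forall a, P a.
Proof.
move=> P0 PD Pm a; have [r [c ->]] := mon_span X a.
by elim: r => [|s r IHr]; rewrite ?big_nil // big_cons; apply: PD.
Qed.

(** Prefixes and suffixes of a nonvanishing word do not vanish, so the product formula of the free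
    algebra survives for its coefficient. By bilinearity only monomials matter, and when
    [u ++ v = s] exactly one cut contributes. *)
Lemma coef_mul_word s a b : ~~ vanish s ->
  coef s (a * b) = \sum_(i < (size s).+1) coef (take i s) a * coef (drop i s) b.
Proof.
move=> nvs; elim/mon_ind: a => [|k a1 a2 IH1 IH2|u].
- by rewrite mul0r raddf0 big1 // => i _; rewrite raddf0 mul0r.
- rewrite mulrDl -scalerAl linearP /= IH1 IH2 mulr_sumr -big_split /=.
  by apply: eq_bigr => i _; rewrite linearP /= mulrDl mulrA.
elim/mon_ind: b => [|k b1 b2 IH1 IH2|v].
- by rewrite mulr0 raddf0 big1 // => i _; rewrite raddf0 mulr0.
- rewrite mulrDr -scalerAr linearP /= IH1 IH2 mulr_sumr -big_split /=.
  by apply: eq_bigr => i _; rewrite linearP /= mulrDr mulrCA.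
have nv i : ~~ vanish (take i s) && ~~ vanish (drop i s).
  rewrite -negb_or; apply: contraNN nvs => /vanish_cat.
  by rewrite cat_take_drop.
rewrite -mon_cat coef_mon nvs /=.
under eq_bigr => i _.
  rewrite !coef_mon; have /andP[-> ->] := nv i; rewrite /= -natrM mulnb.
  over.
have [<-|ne] := eqVneq (u ++ v) s; last first.
  rewrite big1 // => i _; case: eqP => // uE; case: eqP => //= vE.
  by move: ne; rewrite uE vE cat_take_drop eqxx.
have lu : (size u < (size (u ++ v)).+1)%N by rewrite ltnS size_cat leq_addr.
rewrite (bigD1 (Ordinal lu)) //= take_size_cat // drop_size_cat // !eqxx.
rewrite big1 ?addr0 // => i; rewrite -val_eqE /= => ne.
case: eqP => //= uE; case/eqP: ne.
by rewrite {2}uE size_takel // -ltnS.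
Qed.

End MonomialBasis.

(** * Words and monomial ideals in the free algebra *)

Section FreeAlgebra.
Variables (F : fieldType) (m : nat).
Local Notation R := (free_alg F m).
Implicit Types (u v w : {fmonom 'I_m}) (s t : seq 'I_m) (p : R).

Lemma fmonom_mulE u v : mmul u v = FMonom (u ++ v).
Proof. by apply: val_inj; rewrite /= fmM. Qed.

Lemma word_mul u v : word F u * word F v = word F (FMonom (u ++ v)) :> R.
Proof.
rewrite -fmonom_mulE; apply/malgP => w.
by rewrite malgM_def fgmulUU mulr1.
Qed.

Lemma word_nil : word F (FMonom [::]) = 1 :> R.
Proof. by congr word; apply: val_inj; rewrite /= fm1. Qed.

Lemma free_gen_word (i : 'I_m) : free_gen F i = word F (FMonom [:: i]).
Proof. by rewrite /free_gen fmuE. Qed.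

Lemma mcoeff_word u w : (word F u)@_w = (u == w)%:R.
Proof. exact: mcoeffU1. Qed.

Lemma word_sumE p : p = \sum_(w <- msupp p) p@_w *: word F w.
Proof.
rewrite {1}[p]free_algE; apply: eq_bigr => w _; apply/malgP => v.
rewrite [LHS]mcoeffU [RHS](mcoeffZ _ (word F w : R)).
by rewrite [(word F w)@_v]mcoeffU1 mulr_natr.
Qed.

(** Every word in the support of [a i * x i * b i] contains the generator [x i] as a factor, hence
    lies in the ideal; so the ideal is spanned by its words. *)
Lemma mem_monomial_ideal (I : monomial_ideal F m) p :
  p \in (I : {pred R}) <->
  (forall w, p@_w != 0 -> word F w \in (I : {pred R})).
Proof.
have scaleI k (q : R) : q \in (I : {pred R}) -> k *: q \in (I : {pred R}).
  by move=> qI; rewrite -[q]mul1r scalerAl idealMr.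
split=> [|pI]; last first.
  rewrite [p]word_sumE big_seq; apply: rpred_sum => w.
  by rewrite -mcoeff_neq0 => /pI wI; apply: scaleI.
have [W IW] := @monomial_idealP _ _ I.
move=> /IW[n [a [x [b [Wx ->]]]]] w; rewrite raddf_sum /= => cw.
have [i ci] : exists i, (a i * x i * b i)@_w != 0.
  apply/existsP; apply: contraNT cw => /existsPn c0.
  by rewrite big1 // => i _; apply/eqP; rewrite -[_ == _]negbK c0.
have [w0 Ww0 xE] := Wx i.
have w0I : word F w0 \in (I : {pred R}).
  apply/IW; exists 1, (fun=> 1), (fun=> x i), (fun=> 1); split=> //.
  by rewrite big_ord1 mul1r mulr1.
move: ci; rewrite mcoeff_neq0 => /msuppM_le[u [v [uP _ ->]]].
move: uP => /msuppM_le[u1 [u2 [_ u2P ->]]].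
move: u2P; rewrite xE -mcoeff_neq0 mcoeff_word.
have [<- _|_] := eqVneq w0 u2; last by rewrite mulr0n eqxx.
by rewrite !fmonom_mulE -word_mul idealMl // -word_mul idealMr.
Qed.

End FreeAlgebra.

(** * The monomial basis of a quotient by a monomial ideal *)

Section QuotientBasis.
Variables (F : fieldType) (m : nat) (I : monomial_ideal F m).
Local Notation R := (free_alg F m).
Local Notation A := (monomial_alg I).
Implicit Types (s t : seq 'I_m) (a b : A) (p : R).

Definition quot_vanish s : bool := word F (FMonom s) \in (I : {pred R}).

Definition quot_mon s : A := qpi I (word F (FMonom s)).

Definition quot_coef s a : F :=
  if quot_vanish s then 0 else (generic_quotient.repr a : R)@_(FMonom s).

(** Two representatives differ by an element of the ideal, whose support consists of words of the
    ideal; so the coefficient at any other word does not depend on the choice made by [repr]. *)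
Lemma quot_coef_qpi s p :
  quot_coef s (qpi I p) = if quot_vanish s then 0 else p@_(FMonom s).
Proof.
rewrite /quot_coef; case: ifPn => // nv; apply/eqP; rewrite -subr_eq0 -mcoeffB.
apply: contraNT nv => cn.
by have /mem_monomial_ideal := repr_qpi I p; apply.
Qed.

Lemma quot_coef_is_linear s : linear_for *%R (quot_coef s).
Proof.
move=> k a b; have [[p <-] [q <-]] := (qpi_surj a, qpi_surj b).
rewrite -linearP !quot_coef_qpi; case: ifP => _; first by rewrite mulr0 addr0.
by rewrite mcoeffD mcoeffZ.
Qed.

Lemma qpi_eq0 p : qpi I p = 0 <-> p \in (I : {pred R}).
Proof.
rewrite -(raddf0 (qpi I)); split; first by move/qpiP; rewrite subr0.
by move=> pI; apply/qpiP; rewrite subr0.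
Qed.

Lemma quot_coef_inj a : (forall s, quot_coef s a = 0) -> a = 0.
Proof.
have [p <-] := qpi_surj a => E; apply/qpi_eq0/mem_monomial_ideal => -[s].
rewrite -/(quot_vanish s); apply: contraNT => nv.
by rewrite -(E s) quot_coef_qpi (negPf nv).
Qed.

Lemma quot_coef_vanish s a : quot_vanish s -> quot_coef s a = 0.
Proof. by rewrite /quot_coef => ->. Qed.

Lemma quot_coef_mon s t :
  quot_coef s (quot_mon t) = (~~ quot_vanish s && (t == s))%:R.
Proof. by rewrite quot_coef_qpi mcoeff_word; case: ifP. Qed.

Lemma quot_mon_nil : quot_mon [::] = 1.
Proof. by rewrite /quot_mon word_nil rmorph1. Qed.

Lemma quot_mon_cat s t : quot_mon (s ++ t) = quot_mon s * quot_mon t.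
Proof. by rewrite /quot_mon -rmorphM word_mul. Qed.

Lemma quot_vanish_nil : quot_vanish [::] = false.
Proof. by rewrite /quot_vanish word_nil idealr1. Qed.

Lemma quot_mon_span a : exists (r : seq (seq 'I_m)) (c : seq 'I_m -> F),
  a = \sum_(s <- r) c s *: quot_mon s.
Proof.
have [p <-] := qpi_surj a.
exists (map (@fmonom_val _) (msupp p)), (fun s => p@_(FMonom s)).
rewrite big_map {1}[p]word_sumE raddf_sum; apply: eq_bigr => w _.
by rewrite fmK /= linearZ /quot_mon fmK.
Qed.

Definition quot_basis : monomial_basis m A :=
  MonomialBasis quot_coef_is_linear quot_coef_inj quot_coef_vanish
    quot_coef_mon quot_mon_nil quot_mon_cat quot_vanish_nil quot_mon_span.

Lemma letter_quot_basis i : letter quot_basis i = gen I i.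
Proof. by rewrite /gen free_gen_word. Qed.

End QuotientBasis.

(** * Order and degree *)

Section Filtrations.
Variables (F : fieldType) (m : nat) (A : algType F) (X : monomial_basis m A).
Implicit Types (s t : seq 'I_m) (a b : A) (d e n : nat).
Local Notation vanish := (vanish X).
Local Notation mon := (mon X).
Local Notation coef := (coef X).
Local Notation letter := (letter X).

(** In the notation of the overview, [degree_lt k.+1] describes V_k and [order_ge k.+1] describes
    B_{>k}. *)
Definition order_ge d a := forall s, (size s < d)%N -> coef s a = 0.
Definition degree_lt d a := forall s, (d <= size s)%N -> coef s a = 0.

Lemma order_geP d k a b :
  order_ge d a -> order_ge d b -> order_ge d (k *: a + b).
Proof. by move=> ha hb s sd; rewrite linearP /= ha ?hb ?mulr0 ?addr0. Qed.

Lemma degree_ltP d k a b :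
  degree_lt d a -> degree_lt d b -> degree_lt d (k *: a + b).
Proof. by move=> ha hb s sd; rewrite linearP /= ha ?hb ?mulr0 ?addr0. Qed.

Lemma order_ge0 d : order_ge d 0.
Proof. by move=> s _; rewrite raddf0. Qed.

Lemma degree_lt0 d : degree_lt d 0.
Proof. by move=> s _; rewrite raddf0. Qed.

Lemma order_geD d a b : order_ge d a -> order_ge d b -> order_ge d (a + b).
Proof. by move=> ha hb; rewrite -[a]scale1r; apply: order_geP. Qed.

Lemma order_geZ d k a : order_ge d a -> order_ge d (k *: a).
Proof. by move=> ha s sd; rewrite linearZ /= ha ?mulr0. Qed.

Lemma degree_ltB d a b : degree_lt d a -> degree_lt d b -> degree_lt d (a - b).
Proof. by move=> ha hb s sd; rewrite raddfB /= ha ?hb ?subr0. Qed.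

Lemma order_ge_leq d e a : (d <= e)%N -> order_ge e a -> order_ge d a.
Proof. by move=> de ha s sd; apply/ha/(leq_trans sd). Qed.

Lemma degree_lt_leq d e a : (d <= e)%N -> degree_lt d a -> degree_lt e a.
Proof. by move=> de ha s sd; apply/ha/(leq_trans de). Qed.

Lemma degree_lt_mon s : degree_lt (size s).+1 (mon s).
Proof.
move=> t st; rewrite coef_mon; case: eqP => [E|_]; last by rewrite andbF.
by rewrite E ltnn in st.
Qed.

Lemma order_geM d e a b :
  order_ge d a -> order_ge e b -> order_ge (d + e) (a * b).
Proof.
move=> ha hb s sd; have [/coef_vanish -> //|nv] := boolP (vanish s).
rewrite coef_mul_word // big1 // => i _; have [id|di] := ltnP i d.
  by rewrite ha ?mul0r // size_takel // -ltnS.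
rewrite hb ?mulr0 // size_drop ltn_subLR; last by rewrite -ltnS.
by apply: leq_trans sd _; rewrite leq_add2r.
Qed.

Lemma degree_ltM d e a b :
  degree_lt d.+1 a -> degree_lt e b -> degree_lt (d + e) (a * b).
Proof.
move=> ha hb s sd; have [/coef_vanish -> //|nv] := boolP (vanish s).
rewrite coef_mul_word // big1 // => i _; have [di|id] := ltnP d i.
  by rewrite ha ?mul0r // size_takel // -ltnS.
rewrite hb ?mulr0 // size_drop leq_subRL; last by rewrite -ltnS.
by apply: leq_trans _ sd; rewrite leq_add2r.
Qed.

Lemma order_ge_prod n (g : 'I_n -> A) (s : seq 'I_n) :
  (forall i, order_ge 1 (g i)) -> order_ge (size s) (\prod_(i <- s) g i).
Proof.
move=> hg; elim: s => [|i s IHs]; first by move=> t; rewrite ltn0.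
by rewrite big_cons; apply: (order_geM (hg i) IHs).
Qed.

(** Each factor starts in degree one, so a word with as many letters as there are factors only
    arises by taking one letter from each. *)
Lemma coef_prod_lead n (g : 'I_n -> A) (s : seq 'I_n) (v : seq 'I_m) :
  (forall i, order_ge 1 (g i)) -> size v = size s -> ~~ vanish v ->
  coef v (\prod_(i <- s) g i) = \prod_(p <- zip s v) coef [:: p.2] (g p.1).
Proof.
move=> hg; elim: s v => [|i s IHs] [|j v] //= => [_ nv|[sv] nv].
  by rewrite !big_nil -(mon_nil X) coef_mon nv eqxx.
have nv' : ~~ vanish v.
  by apply: contraNN nv => vv; rewrite -cat1s vanish_cat // vv orbT.
(* The empty prefix contributes 0 since [g i] has no constant term; a prefix of two or more letters
   leaves a suffix shorter than the order of the remaining product. *)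
rewrite !big_cons coef_mul_word // big_ord_recl /= hg // mul0r add0r.
rewrite big_ord_recl /= take0 drop0 IHs // [X in _ + X]big1 ?addr0 // => k _.
rewrite (order_ge_prod hg) ?mulr0 // -sv size_drop.
by rewrite ltn_subrL; apply/andP; split => //; case: (size v) k => [[]|].
Qed.

Lemma degree_lt_ex a : exists n, degree_lt n a.
Proof.
elim/(@mon_ind _ _ _ X): a => [|k a b [n an] [n' bn]|s].
- by exists 0%N; apply: degree_lt0.
- exists (maxn n n'); apply: degree_ltP.
    by apply: degree_lt_leq an; apply: leq_maxl.
  by apply: degree_lt_leq bn; apply: leq_maxr.
by exists (size s).+1; apply: degree_lt_mon.
Qed.

Lemma mon_shift_degree (c : 'I_m -> F) s :
  degree_lt (size s) (mon s - \prod_(i <- s) (letter i - (c i)%:A)).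
Proof.
elim: s => [|i s IHs].
  by rewrite mon_nil big_nil subrr; apply: degree_lt0.
set P := \prod_(i <- s) _ in IHs; rewrite big_cons -/P -cat1s mon_cat.
(* Both summands have degree below [(size s).+1]: the first by induction, the second because [P]
   differs from [mon s] only in lower degree. *)
have -> : mon [:: i] * mon s - (letter i - (c i)%:A) * P
          = letter i * (mon s - P) + c i *: P.
  rewrite mulrBl mulrBr opprB -scalerAl mul1r /letter.
  by rewrite -addrA (addrC (c i *: P)).
have Pd : degree_lt (size s).+1 P.
  rewrite -[P](subKr (mon s)); apply: degree_ltB; first exact: degree_lt_mon.
  exact: degree_lt_leq (leqnSn _) IHs.
rewrite addrC; apply: degree_ltP => //=.
exact: (degree_ltM (@degree_lt_mon [:: i])).
Qed.

End Filtrations.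

(** * Dimension count *)

Section WordCoordinates.
Variables (F : fieldType) (m : nat) (A : algType F) (X : monomial_basis m A).
Variable k : nat.
Implicit Types (a b : A).

(** Words of length at most [k] form the finite type [k.-bseq], so the cardinality of this set is
    the dimension of V_k. *)
Definition nonzero_words : {set k.-bseq 'I_m} :=
  [set t : k.-bseq 'I_m | ~~ vanish X t].

Definition nzword (i : 'I_#|nonzero_words|) : seq 'I_m := enum_val i.

Lemma nzwordP i : ~~ vanish X (nzword i).
Proof. by have := enum_valP i; rewrite inE. Qed.

Lemma size_nzword i : (size (nzword i) < k.+1)%N.
Proof. exact: size_bseq. Qed.

Lemma nzword_inj : injective nzword.
Proof. by move=> i j /val_inj/enum_val_inj. Qed.

Lemma nzword_ex s : (size s < k.+1)%N -> ~~ vanish X s ->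
  exists i, nzword i = s.
Proof.
rewrite ltnS => sk nv; have sN : Bseq sk \in nonzero_words by rewrite inE.
by exists (enum_rank_in sN (Bseq sk)); rewrite /nzword enum_rankK_in.
Qed.

Definition word_coords a : 'rV[F]_#|nonzero_words| :=
  \row_i coef X (nzword i) a.

Lemma word_coords_eq0 a : degree_lt X k.+1 a -> word_coords a = 0 -> a = 0.
Proof.
move=> da c0; apply: (coef_ext (X:=X)) => s nv; rewrite raddf0.
have [sk|ks] := ltnP (size s) k.+1; last exact: da.
have [i <-] := nzword_ex sk nv.
by move/rowP: c0 => /(_ i); rewrite !mxE.
Qed.

Lemma degree_lt_sum a : degree_lt X k.+1 a ->
  a = \sum_i word_coords a 0 i *: mon X (nzword i).
Proof.
move=> da; apply: (coef_ext (X:=X)) => s nv; rewrite raddf_sum /=.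
have [sk|ks] := ltnP (size s) k.+1; last first.
  rewrite da // big1 // => i _; rewrite linearZ /= coef_mon.
  case: eqP => [E|]; last by rewrite andbF mulr0.
  by have := size_nzword i; rewrite E ltnNge ks.
have [i <-] := nzword_ex sk nv; rewrite (bigD1 i) //= big1 => [|j ji].
  by rewrite linearZ /= coef_mon nzwordP eqxx mulr1 addr0 mxE.
by rewrite linearZ /= coef_mon (inj_eq nzword_inj) (negPf ji) andbF mulr0.
Qed.

End WordCoordinates.

(** * Truncations and Jacobian of a morphism *)

Section Morphism.
Variables (F : fieldType) (m m' : nat) (A B : algType F).
Variables (X : monomial_basis m A) (Y : monomial_basis m' B).
Variable f : {lrmorphism A -> B}.
Implicit Types (a : A) (b : B) (s : seq 'I_m) (v : seq 'I_m').

(** These are the c_i of the overview, and [shifted] gives its y_i. *)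
Definition const_term (i : 'I_m) : F := coef Y [::] (f (letter X i)).

Definition shifted (i : 'I_m) : A := letter X i - (const_term i)%:A.

Lemma shifted_order i : order_ge Y 1 (f (shifted i)).
Proof.
case=> //= _; rewrite raddfB /= raddfB /= linearZ /= rmorph1 linearZ /=.
by rewrite -(mon_nil Y) coef_mon vanish_nil eqxx mulr1 subrr.
Qed.

Lemma f_prod_shifted s :
  f (\prod_(i <- s) shifted i) = \prod_(i <- s) f (shifted i).
Proof. exact: rmorph_prod. Qed.

Lemma prod_shifted_order s : order_ge Y (size s) (f (\prod_(i <- s) shifted i)).
Proof. by rewrite f_prod_shifted; apply: order_ge_prod shifted_order. Qed.

Lemma coef_prod_shifted s t : (size s <= size t)%N ->
  coef X t (\prod_(i <- s) shifted i) = coef X t (mon X s).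
Proof.
move=> st; have := mon_shift_degree X const_term st.
by rewrite raddfB /= => /subr0_eq ->.
Qed.

(* Replace the monomials of degree n >= k by products of shifted letters,
   which f sends to elements of order n, and induct on n. *)
Lemma degree_lt_dense k n a : degree_lt X n a ->
  exists2 a1, degree_lt X k a1 & order_ge Y k (f a - f a1).
Proof.
elim: n a => [|n IHn] a da.
  exists 0; first exact: degree_lt0.
  by rewrite (coef_inj (fun s => da s isT)) subrr; apply: order_ge0.
have [nk|kn] := ltnP n k.
  exists a; first exact: degree_lt_leq da.
  by rewrite subrr; apply: order_ge0.
pose top : A := \sum_(t : n.-tuple 'I_m) coef X t a *: \prod_(i <- t) shifted i.
have ftop : order_ge Y k (f top).
  rewrite raddf_sum; apply: (big_ind (order_ge Y k)); first exact: order_ge0.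
    exact: order_geD.
  move=> t _ /=; rewrite linearZ /=; apply/order_geZ/(order_ge_leq kn).
  by have := @prod_shifted_order t; rewrite size_tuple.
have dtop : degree_lt X n (a - top).
  move=> s ns; rewrite raddfB /= raddf_sum /=.
  have [sn|sn] := eqVneq (size s) n; last first.
    rewrite da ?ltn_neqAle 1?eq_sym ?sn // big1 ?subrr // => t _.
    rewrite linearZ /= coef_prod_shifted ?size_tuple // coef_mon.
    case: eqP => [E|_]; last by rewrite andbF mulr0.
    by rewrite -E size_tuple eqxx in sn.
  have [/coef_vanish v|nv] := boolP (vanish X s).
    by rewrite v big1 ?subrr // => t _; rewrite v.
  have st : size s == n by rewrite sn.
  rewrite (bigD1 (Tuple st)) //= linearZ /= coef_prod_shifted //.
  rewrite coef_mon nv eqxx mulr1 big1 ?addr0 ?subrr // => t.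
  rewrite -val_eqE /= => ts.
  rewrite linearZ /= coef_prod_shifted ?size_tuple //.
  by rewrite coef_mon (negPf ts) andbF mulr0.
have [a1 d1 o1] := IHn _ dtop; exists a1 => //.
by rewrite -[a](subrK top) rmorphD addrAC; apply: order_geD.
Qed.

Hypothesis f_surj : forall b, exists a, f a = b.

(** Any preimage has finite degree, and [degree_lt_dense] trims it below degree [k] without changing
    its image modulo order [k]. *)
Lemma degree_lt_surj k b :
  exists2 a, degree_lt X k a & order_ge Y k (b - f a).
Proof.
have [a0 <-] := f_surj b; have [n] := degree_lt_ex X a0.
exact: degree_lt_dense.
Qed.

Section Truncation.
Variable k : nat.
Local Notation NX := (nonzero_words X k).
Local Notation NY := (nonzero_words Y k).

(** The map from V_k to B / B_{>k} induced by [f], in the bases of nonzero words, acting on row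
    vectors. *)
Definition trunc_mx : 'M[F]_(#|NX|, #|NY|) :=
  \matrix_i word_coords Y k (f (mon X (nzword i))).

Lemma word_coords_morph a : degree_lt X k.+1 a ->
  word_coords Y k (f a) = word_coords X k a *m trunc_mx.
Proof.
move=> /degree_lt_sum {1}->; rewrite raddf_sum mulmx_sum_row.
apply/rowP => j; rewrite mxE raddf_sum summxE /=; apply: eq_bigr => i _.
by rewrite linearZ /= linearZ /= !mxE.
Qed.

(** The coordinates of lifts to V_k of the basis words of B / B_{>k} are the rows of a left
    inverse. *)
Lemma trunc_mx_full : row_full trunc_mx.
Proof.
apply/row_fullP.
have /boolp.choice[g gP] : forall j, exists a,
    degree_lt X k.+1 a /\ word_coords Y k (f a) = delta_mx 0 j.
  move=> j; have [a da oa] := degree_lt_surj k.+1 (mon Y (nzword j)).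
  exists a; split=> //; apply/rowP => i; rewrite !mxE.
  have := oa (nzword i) (size_nzword i); rewrite raddfB /= => /subr0_eq <-.
  by rewrite coef_mon nzwordP (inj_eq (@nzword_inj _ _ _ _ _)) [j == i]eq_sym.
exists (\matrix_j word_coords X k (g j)); apply/row_matrixP => j.
have [dg cg] := gP j.
by rewrite row_mul rowK -word_coords_morph // cg rowE mulmx1.
Qed.

Lemma nonzero_words_leq : (#|NY| <= #|NX|)%N.
Proof. by rewrite -(eqP trunc_mx_full) rank_leq_row. Qed.

(** The two cardinalities are then equal, so the surjection from V_k to B / B_{>k} is injective. *)
Lemma degree_lt_inj : (#|NX| <= #|NY|)%N ->
  forall a, degree_lt X k.+1 a -> order_ge Y k.+1 (f a) -> a = 0.
Proof.
move=> le a da oa; apply: (@word_coords_eq0 _ _ _ X k a da).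
have free : row_free trunc_mx.
  by rewrite /row_free (eqP trunc_mx_full) eqn_leq nonzero_words_leq.
apply: (row_free_inj free); rewrite mul0mx -word_coords_morph //.
by apply/rowP => j; rewrite !mxE oa // size_nzword.
Qed.
End Truncation.

Definition jacobian : 'M[F]_(m, m') :=
  \matrix_(i, j) coef Y [:: j] (f (letter X i)).

Lemma jacobian_shifted i j : coef Y [:: j] (f (shifted i)) = jacobian i j.
Proof.
rewrite mxE raddfB /= raddfB /= linearZ /= rmorph1 linearZ /=.
by rewrite -(mon_nil Y) coef_mon andbF mulr0 subr0.
Qed.

(** Each letter of [B] is, modulo order 2, the image of some [g j] of degree at most one. The linear
    coefficients of the [g j] form a left inverse of the Jacobian, because [f] sends their constant
    parts to constants. *)
Lemma jacobian_full :
  (forall j, ~~ vanish Y [:: j]) -> row_full jacobian.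
Proof.
move=> nY; apply/row_fullP.
have /boolp.choice[g gP] : forall j, exists a,
    degree_lt X 2 a /\ order_ge Y 2 (letter Y j - f a).
  by move=> j; have [a da oa] := degree_lt_surj 2 (letter Y j); exists a.
exists (\matrix_(j, i) coef X [:: i] (g j)); apply/matrixP => j l.
have [dg og] := gP j.
have gE : g j =
    coef X [::] (g j) *: 1 + \sum_i coef X [:: i] (g j) *: letter X i.
  apply: (coef_ext (X:=X)) => -[|i [|i' s]] nv.
  - rewrite linearP raddf_sum /= -(mon_nil X) coef_mon nv eqxx mulr1.
    by rewrite big1 ?addr0 // => i _; rewrite linearZ /= coef_mon andbF mulr0.
  - rewrite linearP raddf_sum /= -(mon_nil X) coef_mon andbF mulr0 add0r.
    rewrite (bigD1 i) //= linearZ /= coef_mon nv eqxx mulr1.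
    rewrite big1 ?addr0 // => i' ne; rewrite linearZ /= coef_mon.
    by rewrite eqseq_cons (negPf ne) andbF mulr0.
  rewrite dg // linearP raddf_sum /= -(mon_nil X) coef_mon andbF mulr0 add0r.
  rewrite big1 // => i0 _.
  by rewrite linearZ /= coef_mon eqseq_cons !andbF mulr0.
have := og [:: l] isT; rewrite raddfB /= coef_mon nY eqseq_cons eqxx andbT /=.
move/subr0_eq; rewrite gE linearP raddf_sum /= rmorph1 linearP raddf_sum /=.
rewrite -(mon_nil Y) coef_mon andbF mulr0 add0r !mxE => ->.
by apply: eq_bigr => i _; rewrite linearZ /= linearZ /= !mxE.
Qed.

End Morphism.

(** A nonzero determinant has a nonzero term in its expansion over permutations. *)
Lemma row_full_perm (F : fieldType) (n : nat) (M : 'M[F]_n) :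
  row_full M -> exists s : 'S_n, forall i, M i (s i) != 0.
Proof.
rewrite row_full_unit unitmxE unitfE => det0.
have [s sP] : exists s : 'S_n, \prod_i M i (s i) != 0.
  apply/existsP; apply: contraNT det0 => /existsPn s0.
  rewrite /determinant big1 // => s _.
  by have := s0 s; rewrite negbK => /eqP ->; rewrite mulr0.
by exists s => i; move/prodf_neq0: sP; apply.
Qed.

(** * Transfer of nonzero words through the Jacobian *)

Section NonvanishingWords.
Variables (F : fieldType) (m m' : nat) (A B : algType F).
Variables (X : monomial_basis m A) (Y : monomial_basis m' B).
Variable f : {lrmorphism A -> B}.
Hypothesis f_surj : forall b, exists a, f a = b.
Hypothesis card_nonzero_words :
  forall k, (#|nonzero_words X k| <= #|nonzero_words Y k|)%N.

(** As [mon X s] is 0, the product [u] of shifted letters has degree below [size s], while [f u] has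
    order at least [size s]; hence [u = 0]. The Jacobian products are the leading coefficients of
    [f u]. *)
Lemma vanish_jacobian s v : vanish X s -> size v = size s -> ~~ vanish Y v ->
  \prod_(p <- zip s v) jacobian X Y f p.1 p.2 = 0.
Proof.
move=> vs sv nv; pose u := \prod_(i <- s) shifted X Y f i.
have u0 : u = 0.
  have du : degree_lt X (size s) u.
    rewrite -[u](subKr (mon X s)); apply: degree_ltB.
      by rewrite mon_vanish //; apply: degree_lt0.
    exact: mon_shift_degree.
  have ou : order_ge Y (size s) (f u) by exact: prod_shifted_order.
  (* [degree_lt_inj] speaks of [k.+1], so [s] must be nonempty, as it is because the empty word
     never vanishes; [k] is the length of its tail. *)
  case: s vs sv @u du ou => [|i s] vs sv u du ou.
    by rewrite vanish_nil in vs.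
  exact: (degree_lt_inj f_surj (card_nonzero_words (size s)) du ou).
have := coef_prod_lead (@shifted_order _ _ _ _ _ X Y f) sv nv.
rewrite -f_prod_shifted -/u u0 !raddf0 => /esym.
by under eq_bigr do rewrite jacobian_shifted.
Qed.

(** Any choice of a nonzero entry in each column works, injective or not; a non-injective choice
    later rules out extra nonzero entries in the projectively simple case. *)
Lemma nonvanish_map (h : 'I_m' -> 'I_m) v :
  (forall j, jacobian X Y f (h j) j != 0) -> ~~ vanish Y v ->
  ~~ vanish X (map h v).
Proof.
move=> hj nv; apply/negP => /vanish_jacobian/(_ _ nv).
rewrite size_map => /(_ erefl)/eqP; apply/negP; rewrite prodf_seq_neq0.
by elim: v {nv} => //= j v ->; rewrite hj.
Qed.

End NonvanishingWords.

(** * Finite-dimensionality and maps between monomial bases *)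

Section FiniteDimension.
Variables (F : fieldType) (m : nat) (A : algType F) (X : monomial_basis m A).

(** A finite spanning family has bounded degree, so a longer word has coefficient 0 even in its own
    monomial. Conversely, finitely many nonzero words span. *)
Lemma finite_dimensional_words :
  finite_dimensional A <->
  exists k, forall s, (k <= size s)%N -> vanish X s.
Proof.
split=> [[n [e eP]]|[k kP]].
  have /boolp.choice[d dP] : forall i, exists d, degree_lt X d (e i).
    by move=> i; apply: degree_lt_ex.
  exists (\max_i d i) => s ds.
  have /eqP : coef X s (mon X s) = 0.
    have [c ->] := eP (mon X s); rewrite raddf_sum big1 //= => i _.
    by rewrite linearZ /= dP ?mulr0 //; apply: leq_trans ds; apply: leq_bigmax.
  by rewrite coef_mon eqxx andbT; case: vanish => //; rewrite oner_eq0.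
exists #|nonzero_words X k|, (fun i => mon X (nzword i)) => a.
exists (word_coords X k a 0); apply: degree_lt_sum => s ks.
by apply: coef_vanish; apply: kP; apply: ltnW.
Qed.

Lemma infinite_dimensional_words k :
  ~ finite_dimensional A -> exists2 s, (k <= size s)%N & ~~ vanish X s.
Proof.
move=> infA; apply: contrapT => H; apply/infA/finite_dimensional_words.
by exists k => s ks; apply/negPn/negP => ns; apply: H; exists s.
Qed.

End FiniteDimension.

Section MonomialMap.
Variables (F : fieldType) (m m' : nat) (A B : algType F).
Variables (X : monomial_basis m A) (Y : monomial_basis m' B).
Variable phi : 'I_m -> 'I_m'.
Hypothesis vanish_phi : forall s, vanish X s -> vanish Y (map phi s).

Lemma support_ex a : exists2 r : seq (seq 'I_m), uniq r &
  forall s, s \notin r -> coef X s a = 0.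
Proof.
have [r [c ->]] := mon_span X a; exists (undup r); first exact: undup_uniq.
move=> s; rewrite mem_undup => sr; rewrite raddf_sum big_seq big1 //= => t tr.
rewrite linearZ /= coef_mon; case: eqP => [E|]; last by rewrite andbF mulr0.
by rewrite -E tr in sr.
Qed.

Definition support a : seq (seq 'I_m) := projT1 (cid2 (support_ex a)).

(** The linear extension of the relettering [phi]; the chosen list may contain words of coefficient
    0, so sums can be compared over a common larger list. *)
Definition monomial_map a : B :=
  \sum_(s <- support a) coef X s a *: mon Y (map phi s).

Lemma monomial_mapE r a : uniq r -> {subset support a <= r} ->
  monomial_map a = \sum_(s <- r) coef X s a *: mon Y (map phi s).
Proof.
move=> ur ar; have [ua sa] : uniq (support a) /\
    forall s, s \notin support a -> coef X s a = 0.
  by rewrite /support; case: cid2.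
rewrite (bigID (mem (support a))) /= [X in _ + X]big1 ?addr0; last first.
  by move=> s /sa ->; rewrite scale0r.
rewrite -big_filter; apply: perm_big; apply: uniq_perm => //.
  exact: filter_uniq.
move=> s; rewrite mem_filter /=.
by case: (boolP (s \in support a)) => // /ar ->.
Qed.

Lemma monomial_map_is_linear : linear monomial_map.
Proof.
move=> k a b; pose r := undup (support (k *: a + b) ++ support a ++ support b).
have rE c : {subset support c <= r} ->
    monomial_map c = \sum_(s <- r) coef X s c *: mon Y (map phi s).
  by move=> cr; apply: monomial_mapE => //; apply: undup_uniq.
rewrite !rE; try by move=> s sr; rewrite mem_undup !mem_cat sr ?orbT.
rewrite scaler_sumr -big_split; apply: eq_bigr => s _ /=.
by rewrite linearP scalerDl scalerA.
Qed.

Lemma monomial_map_mon s : monomial_map (mon X s) = mon Y (map phi s).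
Proof.
pose r := undup (s :: support (mon X s)).
rewrite (@monomial_mapE r) ?undup_uniq //; last first.
  by move=> t tr; rewrite mem_undup inE tr orbT.
have sr : s \in r by rewrite mem_undup mem_head.
rewrite (bigD1_seq s) ?undup_uniq //= big1 ?addr0 => [|t ts].
  (* If [s] vanishes its coefficient is 0 by convention, and [vanish_phi] makes the right-hand side
     0 as well. *)
  rewrite coef_mon eqxx andbT; case: (boolP (vanish X s)) => [|_].
    by move=> /vanish_phi/mon_vanish ->; rewrite scaler0.
  exact: scale1r.
by rewrite coef_mon eq_sym (negPf ts) andbF scale0r.
Qed.

Lemma monomial_map_is_monoid_morphism : monoid_morphism monomial_map.
Proof.
have linE k a b : monomial_map (k *: a + b) =
    k *: monomial_map a + monomial_map b by exact: monomial_map_is_linear.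
have map0 : monomial_map 0 = 0.
  by have := linE (-1) 0 0; rewrite !scaleN1r !addNr.
split=> [|a b]; first by rewrite -(mon_nil X) monomial_map_mon mon_nil.
elim/(@mon_ind _ _ _ X): a => [|k a1 a2 IH1 IH2|s].
- by rewrite !(map0, mul0r).
- by rewrite mulrDl -scalerAl !linE IH1 IH2 mulrDl -scalerAl.
elim/(@mon_ind _ _ _ X): b => [|k b1 b2 IH1 IH2|t].
- by rewrite !(map0, mulr0).
- by rewrite mulrDr -scalerAr !linE IH1 IH2 mulrDr -scalerAr.
by rewrite -mon_cat !monomial_map_mon map_cat mon_cat.
Qed.

Lemma monomial_map_ex : exists h : {lrmorphism A -> B},
  forall s, h (mon X s) = mon Y (map phi s).
Proof.
pose hl := GRing.isLinear.Build F A B *:%R monomial_map monomial_map_is_linear.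
pose hm := GRing.isMonoidMorphism.Build A B monomial_map
  monomial_map_is_monoid_morphism.
pose h : {lrmorphism A -> B} := HB.pack monomial_map hl hm.
by exists h => s; apply: monomial_map_mon.
Qed.

End MonomialMap.

(** * Isomorphisms and permutations of the letters *)

Lemma lrmorphism_mon_id (F : fieldType) (m : nat) (A : algType F)
    (X : monomial_basis m A) (h : {linear A -> A}) :
  (forall s, h (mon X s) = mon X s) -> forall a, h a = a.
Proof.
move=> hE; elim/(@mon_ind _ _ _ X) => [|k a b Ha Hb|//]; first exact: raddf0.
by rewrite linearP Ha Hb.
Qed.

Lemma lrmorphism_inverse (F : fieldType) (A B : algType F)
    (f : {lrmorphism A -> B}) : bijective f ->
  exists g : {lrmorphism B -> A}, cancel f g /\ cancel g f.
Proof.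
case=> g fK gK.
pose gz := GRing.isZmodMorphism.Build B A g (can2_zmod_morphism fK gK).
pose gm := GRing.isMonoidMorphism.Build B A g (can2_monoid_morphism fK gK).
pose gs := GRing.isScalable.Build F B A *:%R g (can2_scalable fK gK).
by pose G : {lrmorphism B -> A} := HB.pack g gz gm gs; exists G.
Qed.

Lemma letters_leq (F : fieldType) (m m' : nat) (A B : algType F)
    (X : monomial_basis m A) (Y : monomial_basis m' B)
    (f : {lrmorphism A -> B}) :
  (forall b, exists a, f a = b) -> (forall j, ~~ vanish Y [:: j]) ->
  (m' <= m)%N.
Proof.
move=> fs nY; have /eqP <- := jacobian_full X fs nY; exact: rank_leq_row.
Qed.

Lemma surj_jacobian_perm (F : fieldType) (m : nat) (A B : algType F)
    (X : monomial_basis m A) (Y : monomial_basis m B)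
    (f : {lrmorphism A -> B}) :
  (forall b, exists a, f a = b) -> (forall j, ~~ vanish Y [:: j]) ->
  exists s : 'S_m, forall i, jacobian X Y f i (s i) != 0.
Proof. by move=> fs nY; apply/row_full_perm/jacobian_full. Qed.

Lemma iso_nonvanish_perm (F : fieldType) (m : nat) (A B : algType F)
    (X : monomial_basis m A) (Y : monomial_basis m B)
    (f : {lrmorphism A -> B}) (g : {lrmorphism B -> A}) :
  cancel f g -> cancel g f -> (forall j, ~~ vanish Y [:: j]) ->
  exists s : 'S_m, forall v, ~~ vanish Y v -> ~~ vanish X (map s v).
Proof.
move=> fK gK nY; have fs b : exists a, f a = b by exists (g b).
have gs a : exists b, g b = a by exists (f a).
(* [s] goes from letters of [A] to letters of [B], so words of [B] are pulled back along its
   inverse. The required inequality of dimensions comes from the surjectivity of [g]. *)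
have [s sP] := surj_jacobian_perm X fs nY; exists s^-1%g => v.
apply: (nonvanish_map fs) => [k|j]; first exact: (nonzero_words_leq _ _ gs).
by have := sP (s^-1%g j); rewrite permKV.
Qed.

Lemma iso_perm (F : fieldType) (m : nat) (A B : algType F)
    (X : monomial_basis m A) (Y : monomial_basis m B)
    (f : {lrmorphism A -> B}) (g : {lrmorphism B -> A}) :
  cancel f g -> cancel g f ->
  (forall i, ~~ vanish X [:: i]) -> (forall j, ~~ vanish Y [:: j]) ->
  exists s : 'S_m, forall v, vanish X v = vanish Y (map s v).
Proof.
move=> fK gK nX nY.
have [s sP] := iso_nonvanish_perm X fK gK nY.
have [t tP] := iso_nonvanish_perm Y gK fK nX.
(* [t * s] applies [t] and then [s], so its powers preserve the nonzero words of [A]. *)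
have rP n v : ~~ vanish X v -> ~~ vanish X (map ((t * s) ^+ n)%g v).
  move=> nv; elim: n => [|n IHn].
    by rewrite (eq_map (g := id)) ?map_id // => i; rewrite expg0 perm1.
  move/tP/sP: IHn; rewrite -!map_comp.
  by rewrite (eq_map (g := ((t * s) ^+ n.+1)%g)) // => i; rewrite expgSr !permM.
exists t => v; apply/idP/idP; last exact/contraTT/tP.
(* The power of [t * s] with exponent one less than its order is its inverse; after [s] it leads
   from [map t v] back to [v]. *)
apply: contraLR => /sP/(rP #[t * s]%g.-1); rewrite -!map_comp.
rewrite (eq_map (g := id)) ?map_id // => i /=.
by rewrite -[s (t i)]permM -permM -expgS prednK ?order_gt0 // expg_order perm1.
Qed.

(** The reletterings by [s] and its inverse both respect vanishing and are mutually inverse on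
    monomials. *)
Lemma perm_iso_ex (F : fieldType) (m : nat) (A B : algType F)
    (X : monomial_basis m A) (Y : monomial_basis m B) (s : 'S_m) :
  (forall v, vanish X v = vanish Y (map s v)) ->
  exists f : {lrmorphism A -> B},
    bijective f /\ forall i, f (letter X i) = letter Y (s i).
Proof.
move=> sP.
have [f fE] : exists f : {lrmorphism A -> B},
    forall v, f (mon X v) = mon Y (map s v).
  by apply: monomial_map_ex => v; rewrite sP.
have [g gE] : exists g : {lrmorphism B -> A},
    forall v, g (mon Y v) = mon X (map s^-1%g v).
  by apply: monomial_map_ex => v; rewrite sP (mapK (permKV s)).
exists f; split=> [|i]; last exact: fE.
exists g.
  apply: (lrmorphism_mon_id (X := X) (h := g \o f)) => v.
  by rewrite /= fE gE (mapK (permK s)).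
apply: (lrmorphism_mon_id (X := Y) (h := f \o g)) => v.
by rewrite /= gE fE (mapK (permKV s)).
Qed.

(* If jacobian i j and jacobian i (s i) are nonzero with j <> s i, a nonzero
   word of B pulls back to a nonzero word of A where i stands for j, so that
   the letter s^-1 j never occurs: by projective simplicity such words have
   bounded length. *)
Lemma jacobian_monomial (F : fieldType) (m : nat) (A B : algType F)
    (X : monomial_basis m A) (Y : monomial_basis m B)
    (f : {lrmorphism A -> B}) (g : {lrmorphism B -> A}) :
  cancel f g -> cancel g f -> (forall j, ~~ vanish Y [:: j]) ->
  ~ finite_dimensional B ->
  (forall l, exists k, forall v, (k <= size v)%N -> l \notin v -> vanish X v) ->
  exists s : 'S_m, (forall i, jacobian X Y f i (s i) != 0) /\
    forall i j, j != s i -> jacobian X Y f i j = 0.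
Proof.
move=> fK gK nY infB avoid; have fs b : exists a, f a = b by exists (g b).
have gs a : exists b, g b = a by exists (f a).
have [s sP] := surj_jacobian_perm X fs nY; exists s; split=> // i j js.
apply/eqP/negPn/negP => Jij.
pose h x := if x == j then i else (s^-1%g x).
have [k kP] := avoid (s^-1%g j).
have [v kv nv] := infinite_dimensional_words Y k infB.
suff: ~~ vanish X (map h v).
  rewrite kP ?size_map //; apply/mapP => -[x _]; rewrite /h.
  case: eqP => [_ ji|xj /perm_inj/esym//].
  by rewrite -ji permKV eqxx in js.
apply: (nonvanish_map fs _ _ nv) => [k'|x].
  exact: (nonzero_words_leq _ _ gs).
rewrite /h; have [->//|_] := eqVneq x j.
by have := sP (s^-1%g x); rewrite permKV.
Qed.

(** * The quotient by a letter *)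

Section AdjoinLetter.
Variables (F : fieldType) (m : nat) (I : monomial_ideal F m) (l : 'I_m).
Local Notation R := (free_alg F m).

Definition adjoined (w : {fmonom 'I_m}) : bool :=
  (word F w \in (I : {pred R})) || (l \in (w : seq 'I_m)).

(** The ideal generated by [I] and the letter [l], encoded by supports so that its words can be read
    off directly. *)
Definition adjoin_letter (p : R) : bool :=
  `[< forall w, p@_w != 0 -> adjoined w >].

Lemma adjoined_mul u v : adjoined u || adjoined v -> adjoined (mmul u v).
Proof.
rewrite /adjoined fmonom_mulE -word_mul mem_cat.
by case/orP=> /orP[]; [move/idealMl->|move->|move/(idealMr _)->|move->];
  rewrite ?orbT.
Qed.

Lemma adjoin_letterP p :
  reflect (forall w, p@_w != 0 -> adjoined w) (p \in adjoin_letter).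
Proof. exact: asboolP. Qed.

Lemma adjoin_letter_closed : idealr_closed adjoin_letter.
Proof.
split.
- by apply/adjoin_letterP => w; rewrite mcoeff0 eqxx.
- apply/adjoin_letterP => /(_ (FMonom [::])).
  rewrite -word_nil mcoeff_word eqxx oner_eq0 /adjoined word_nil idealr1.
  by move=> /(_ isT).
move=> a u v /adjoin_letterP uP /adjoin_letterP vP; apply/adjoin_letterP => w.
rewrite mcoeffD; have [->|nz _] := eqVneq (a * u)@_w 0.
  by rewrite add0r; apply: vP.
move: nz; rewrite mcoeff_neq0 => /msuppM_le[w1 [w2 [_ w2u ->]]].
by apply: adjoined_mul; rewrite (uP w2) ?orbT // mcoeff_neq0.
Qed.
HB.instance Definition _ := isIdealr.Build R adjoin_letter adjoin_letter_closed.

Lemma adjoin_letterMl a : {in adjoin_letter, forall u, u * a \in adjoin_letter}.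
Proof.
move=> u /adjoin_letterP uP; apply/adjoin_letterP => w.
rewrite mcoeff_neq0 => /msuppM_le[w1 [w2 [w1u _ ->]]].
by apply: adjoined_mul; rewrite (uP w1) // mcoeff_neq0.
Qed.
HB.instance Definition _ := isMulrStable.Build R adjoin_letter adjoin_letterMl.

Lemma adjoin_letter_monomial : exists W : {fmonom 'I_m} -> Prop, forall p,
  p \in adjoin_letter <->
    ideal_generated (fun q => exists2 w, W w & q = word F w) p.
Proof.
exists adjoined => p; split=> [/adjoin_letterP pP|].
  pose w i := (tnth (in_tuple (msupp p)) i).
  exists (size (msupp p)), (fun i => p@_(w i) *: 1),
    (fun i => word F (w i)), (fun=> 1).
  split=> [i|].
    by exists (w i) => //; apply: pP; rewrite mcoeff_neq0 mem_tnth.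
  rewrite {1}[p]word_sumE big_tnth; apply: eq_bigr => i _.
  by rewrite mulr1 -scalerAl mul1r.
move=> [n [a [x [b [Wx ->]]]]]; apply: rpred_sum => i _.
apply: adjoin_letterMl; apply: idealMr; have [w Ww ->] := Wx i.
apply/adjoin_letterP => v; rewrite mcoeff_word.
by have [<-|_] := eqVneq w v; rewrite ?mulr0n ?eqxx.
Qed.
HB.instance Definition _ := isMonomialIdeal.Build F m adjoin_letter
  adjoin_letter_monomial.

Lemma quot_vanish_adjoin s :
  quot_vanish adjoin_letter s = quot_vanish I s || (l \in s).
Proof.
apply/adjoin_letterP/idP => [/(_ (FMonom s))|vs w].
  by rewrite mcoeff_word eqxx oner_eq0; apply.
rewrite mcoeff_word; have [<-|_] := eqVneq _ w; last by rewrite mulr0n eqxx.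
by rewrite /adjoined.
Qed.

End AdjoinLetter.

(** Killing the nonzero letter [l] gives a proper graded image, which is finite-dimensional; its
    nonzero words are those of the original algebra that avoid [l], so these have bounded length. *)
Lemma projectively_simple_avoid (F : fieldType) (m : nat)
    (I : monomial_ideal F m) (l : 'I_m) :
  projectively_simple (monomial_alg I) -> ~~ quot_vanish I [:: l] ->
  exists k, forall v, (k <= size v)%N -> l \notin v -> quot_vanish I v.
Proof.
move=> [_ simple] nl.
pose X := quot_basis I; pose Y := quot_basis (adjoin_letter I l).
have [f fE] : exists f : {lrmorphism monomial_alg I ->
    monomial_alg (adjoin_letter I l)}, forall s, f (mon X s) = mon Y (map id s).
  by apply: monomial_map_ex => s; rewrite map_id /= quot_vanish_adjoin => ->.
(* Thus [f] is the canonical projection, hence graded and surjective. *)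
have fE' p : f (qpi I p) = qpi (adjoin_letter I l) p.
  rewrite [p]word_sumE !raddf_sum; apply: eq_bigr => w _ /=.
  rewrite linearZ linearZ [RHS]linearZ /=; congr (_ *: _).
  by have := fE w; rewrite map_id /= /quot_mon fmK.
have /finite_dimensional_words-/(_ _ Y)[k kP] :
    finite_dimensional (monomial_alg (adjoin_letter I l)).
  apply: (simple _ f).
  - by move=> d _ [p hp ->]; exists p.
  - by move=> c; have [p <-] := qpi_surj c; exists (qpi I p).
  move=> f_inj; have : mon X [:: l] = 0.
    apply: f_inj; rewrite raddf0 fE map_id; apply: mon_vanish.
    by rewrite /= quot_vanish_adjoin mem_head orbT.
  move/(congr1 (coef X [:: l])); rewrite raddf0 coef_mon eqxx andbT /= nl.
  by move/eqP; rewrite oner_eq0.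
exists k => v /kP; rewrite /= quot_vanish_adjoin => /orP[//|lv].
by rewrite lv.
Qed.

(** * Isomorphisms of monomial algebras *)

Lemma quot_vanish_letter (F : fieldType) (m : nat) (I : monomial_ideal F m) i :
  free_gen F i \notin (I : {pred free_alg F m}) -> ~~ quot_vanish I [:: i].
Proof. by rewrite free_gen_word. Qed.

Lemma iso_letters_eq (F : fieldType) (m m' : nat)
    (I : monomial_ideal F m) (J : monomial_ideal F m')
    (f : {lrmorphism monomial_alg I -> monomial_alg J}) :
  (forall i, free_gen F i \notin (I : {pred free_alg F m})) ->
  (forall i, free_gen F i \notin (J : {pred free_alg F m'})) ->
  bijective f -> m = m'.
Proof.
move=> nI nJ /lrmorphism_inverse[g [fK gK]]; apply/eqP; rewrite eqn_leq.
apply/andP; split.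
  apply: (@letters_leq _ _ _ _ _ (quot_basis J) (quot_basis I) g).
    by move=> a; exists (f a).
  by move=> i; apply: quot_vanish_letter.
apply: (@letters_leq _ _ _ _ _ (quot_basis I) (quot_basis J) f).
  by move=> b; exists (g b).
by move=> i; apply: quot_vanish_letter.
Qed.

Lemma morph_letterE (F : fieldType) (m m' : nat) (A B : algType F)
    (X : monomial_basis m A) (Y : monomial_basis m' B)
    (f : {lrmorphism A -> B}) i j :
  (forall v, size v != 1%N -> coef Y v (f (letter X i)) = 0) ->
  (forall k, k != j -> jacobian X Y f i k = 0) ->
  f (letter X i) = jacobian X Y f i j *: letter Y j.
Proof.
move=> f1 Jij; apply: (coef_ext (X := Y)) => v nv.
rewrite linearZ /= coef_mon nv /=; case: v nv => [|k [|? ?]] nv.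
- by rewrite f1 ?mulr0.
- have -> : coef Y [:: k] (f (letter X i)) = jacobian X Y f i k by rewrite mxE.
  have [->|kj] := eqVneq k j; first by rewrite eqxx mulr1.
  by rewrite Jij // eqseq_cons eq_sym (negPf kj) mulr0.
by rewrite f1 // eqseq_cons andbF mulr0.
Qed.

(** Gradedness reduces the image of a letter to its linear part, given by a row of the Jacobian;
    projective simplicity leaves one nonzero entry in that row. *)
Lemma graded_iso_monomial (F : fieldType) (m m' : nat)
    (I : monomial_ideal F m) (J : monomial_ideal F m')
    (f : {lrmorphism monomial_alg I -> monomial_alg J}) :
  (forall i, free_gen F i \notin (I : {pred free_alg F m})) ->
  (forall i, free_gen F i \notin (J : {pred free_alg F m'})) ->
  projectively_simple (monomial_alg I) ->
  projectively_simple (monomial_alg J) ->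
  bijective f -> graded_map f ->
  exists (e : m = m') (s : 'S_m) (lambda : 'I_m -> F),
    (forall i, lambda i != 0) /\
    forall i, f (gen I i) = lambda i *: gen J (cast_ord e (s i)).
Proof.
move=> nI nJ psI [infJ _] fbij fgr.
have e := iso_letters_eq nI nJ fbij; subst m'.
have [g [fK gK]] := lrmorphism_inverse fbij.
pose X := quot_basis I; pose Y := quot_basis J.
have [i|l|s [s_neq0 s_eq0]] := @jacobian_monomial _ _ _ _ X Y f g fK gK _ infJ.
- exact: quot_vanish_letter.
- exact/(projectively_simple_avoid psI)/quot_vanish_letter.
exists erefl, s, (fun i => jacobian X Y f i (s i)); split=> // i.
rewrite cast_ord_id -!letter_quot_basis.
have [p hp fp] : homog 1%N (f (letter X i)).
  apply: fgr; exists (free_gen F i); last by rewrite letter_quot_basis.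
  by move=> w; rewrite free_gen_word mcoeff_word; have [<-|_] := eqVneq _ w;
    rewrite ?mulr0n ?eqxx.
apply: (morph_letterE (X := X) (Y := Y)) (s_eq0 i) => v v1.
rewrite fp [LHS]quot_coef_qpi; case: ifP => // _; apply/eqP; apply: contraNT v1.
by move/hp/eqP.
Qed.

Lemma iso_permutes_letters (F : fieldType) (m m' : nat)
    (I : monomial_ideal F m) (J : monomial_ideal F m')
    (f : {lrmorphism monomial_alg I -> monomial_alg J}) :
  (forall i, free_gen F i \notin (I : {pred free_alg F m})) ->
  (forall i, free_gen F i \notin (J : {pred free_alg F m'})) ->
  bijective f ->
  exists (e : m = m') (s : 'S_m)
    (h : {lrmorphism monomial_alg I -> monomial_alg J}),
    bijective h /\ forall i, h (gen I i) = gen J (cast_ord e (s i)).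
Proof.
move=> nI nJ fbij; have e := iso_letters_eq nI nJ fbij; subst m'.
have [g [fK gK]] := lrmorphism_inverse fbij.
have [i|i|s sP] := @iso_perm _ _ _ _ (quot_basis I) (quot_basis J) f g fK gK.
- exact: quot_vanish_letter.
- exact: quot_vanish_letter.
have [h [hbij hE]] := perm_iso_ex sP.
exists erefl, s, h; split=> // i.
by rewrite cast_ord_id -!letter_quot_basis.
Qed.

Lemma lrmorphism_letter_ext (F : fieldType) (m : nat) (A B : algType F)
    (X : monomial_basis m A) (f g : {lrmorphism A -> B}) :
  (forall i, f (letter X i) = g (letter X i)) -> f =1 g.
Proof.
move=> fg; elim/(@mon_ind _ _ _ X) => [|k a b Ha Hb|s].
- by rewrite !raddf0.
- by rewrite !linearP /= Ha Hb.
by rewrite mon_prod !rmorph_prod; apply: eq_bigr => i _; apply: fg.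
Qed.

Lemma letter_scale_inj (F : fieldType) (m : nat) (A : algType F)
    (X : monomial_basis m A) (c d : F) i j :
  ~~ vanish X [:: i] -> c != 0 -> c *: letter X i = d *: letter X j ->
  i = j /\ c = d.
Proof.
move=> nv c0 /(congr1 (coef X [:: i])).
rewrite !linearZ /= !coef_mon nv eqxx mulr1 /= eqseq_cons andbT.
have [->|_] := eqVneq j i; first by rewrite mulr1.
by rewrite mulr0 => c_0; rewrite c_0 eqxx in c0.
Qed.

(** * Graded automorphisms inside the wreath product *)

Section Wreath.
Variables (F : fieldType) (n : nat) (I : monomial_ideal F n).
Hypothesis nI : forall i, free_gen F i \notin (I : {pred free_alg F n}).
Hypothesis psI : projectively_simple (monomial_alg I).

Definition acts_as (f : monomial_alg I -> monomial_alg I)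
    (w : wreath (Gm F) n) :=
  forall i, f (gen I i) = Gm_val (wr_scale w i) *: gen I (wr_perm w i).

(** Distinct nonzero letters are linearly independent. This uniqueness makes the chosen [theta]
    multiplicative. *)
Lemma acts_as_inj f w1 w2 : acts_as f w1 -> acts_as f w2 -> w1 = w2.
Proof.
move=> w1P w2P; have E i : wr_perm w1 i = wr_perm w2 i /\
    Gm_val (wr_scale w1 i) = Gm_val (wr_scale w2 i).
  apply: (@letter_scale_inj _ _ _ (quot_basis I)).
  - exact: quot_vanish_letter.
  - exact: Gm_neq0.
  by rewrite !letter_quot_basis -w1P -w2P.
case: w1 w2 E {w1P w2P} => [a s] [b t] /= E; congr Wreath.
  by apply/ffunP => i; apply: val_inj; case: (E i).
by apply/permP => i; case: (E i).
Qed.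

Lemma acts_as_ex (f : graded_aut (monomial_alg I)) : exists w, acts_as f w.
Proof.
have [e [s [l [l0 fE]]]] := graded_iso_monomial nI nI psI psI (aut_bij f)
  (@aut_graded _ _ f).
exists (Wreath [ffun i => MkGm (l0 i)] s) => i.
by rewrite fE cast_ord_id /= ffunE.
Qed.

Lemma graded_aut_wreath :
  exists theta : {multiplicative graded_aut (monomial_alg I)
                    -> wreath (Gm F) n},
    injective theta /\
    forall (f : graded_aut (monomial_alg I)) (i : 'I_n), f (gen I i) =
      Gm_val (wr_scale (theta f) i) *: gen I (wr_perm (theta f) i).
Proof.
have /boolp.choice[theta thetaP] := acts_as_ex.
have thetaM : {morph theta : f g / (f * g)%g >-> (f * g)%g}.
  move=> f g; apply: (@acts_as_inj (f * g)%g); first exact: thetaP.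
  (* [f * g] applies [f] first, so with images (a, s) and (b, t) it sends x_i to a_i b_(s i) x_(t (s
     i)), which is the wreath product law. *)
  move=> i; rewrite /= thetaP linearZ /= thetaP scalerA.
  by rewrite ffunE permM.
pose thetam := monoid.isMultiplicative.Build (graded_aut (monomial_alg I))
  (wreath (Gm F) n) theta thetaM.
pose Theta : {multiplicative graded_aut (monomial_alg I) -> wreath (Gm F) n} :=
  HB.pack theta thetam.
exists Theta; split=> [f g fg|]; last exact: thetaP.
apply: graded_autP; apply: (lrmorphism_letter_ext (X := quot_basis I)) => i.
by rewrite letter_quot_basis !thetaP (fg : theta f = theta g).
Qed.

End Wreath.

Theorem theorem1p5 (F : fieldType) :
  (forall (m m' : nat) (I : monomial_ideal F m) (J : monomial_ideal F m'),
     (forall i : 'I_m, free_gen F i \notin (I : {pred free_alg F m})) ->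
     (forall i : 'I_m', free_gen F i \notin (J : {pred free_alg F m'})) ->
     ((exists f : {lrmorphism monomial_alg I -> monomial_alg J}, bijective f) ->
      exists (e : m = m') (s : 'S_m)
        (f : {lrmorphism monomial_alg I -> monomial_alg J}),
        bijective f /\ forall i, f (gen I i) = gen J (cast_ord e (s i))) /\
     (projectively_simple (monomial_alg I) ->
      projectively_simple (monomial_alg J) ->
      forall f : {lrmorphism monomial_alg I -> monomial_alg J},
        bijective f -> graded_map f ->
        exists (e : m = m') (s : 'S_m) (lambda : 'I_m -> F),
          (forall i, lambda i != 0) /\
          forall i, f (gen I i) = lambda i *: gen J (cast_ord e (s i)))) /\
  (forall (n : nat) (I : monomial_ideal F n),
     (forall i : 'I_n, free_gen F i \notin (I : {pred free_alg F n})) ->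
     projectively_simple (monomial_alg I) ->
     exists theta : {multiplicative graded_aut (monomial_alg I)
                       -> wreath (Gm F) n},
       injective theta /\
       forall (f : graded_aut (monomial_alg I)) (i : 'I_n), f (gen I i) =
         Gm_val (wr_scale (theta f) i) *: gen I (wr_perm (theta f) i)).
Proof.
split=> [m m' I J nI nJ|n I nI psI].
  split=> [[f fbij]|psI psJ f]; last exact: graded_iso_monomial.
  exact: iso_permutes_letters fbij.
exact: graded_aut_wreath.
Qed.
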